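(* Let $G$ be a finite simple graph of order $n$, size $m$, and minimum degree $\delta(G)\geq 2$, and let $k\geq 2$ be an integer. Then $$\gamma_{st}(G^{\frac{1}{k}})\leq\begin{cases} n & \text{if } k=2,3,\\ n+m\left\lceil \frac{k-3}{3}\right\rceil & \text{otherwise.}\end{cases}$$
   Context: For a finite simple graph $G$, a set $D\subseteq V(G)$ is a strong dominating set of $G$ if for every vertex $x\in V(G)\setminus D$ there is a vertex $y\in D$ with $xy\in E(G)$ and $\deg(x)\leq\deg(y)$ (degrees taken in $G$). The strong domination number $\gamma_{st}(G)$ is the minimum cardinality of a strong dominating set of $G$. The order and size of $G$ are its numbers of vertices and edges. The $k$-subdivision $G^{\frac{1}{k}}$ of $G$ is obtained by replacing each edge $v_iv_j$ of $G$ with a path of length $k$ between $v_i$ and $v_j$ (with $k-1$ new internal vertices, distinct for different edges); thus it has $n+(k-1)m$ vertices and $km$ edges. *)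

(* Defs.v *)
From mathcomp Require Import all_boot all_order all_algebra.

Set Implicit Arguments.
Unset Strict Implicit.
Unset Printing Implicit Defensive.

Record sgraph := SGraph {
  vertex :> finType;
  adj : rel vertex;
  adj_sym : symmetric adj;
  adj_irrefl : irreflexive adj
}.

Definition edges (G : sgraph) : {set {set G}} :=
  [set f : {set G} | [exists x, exists y, adj x y && (f == [set x; y])]].

Definition gorder (G : sgraph) : nat := #|G|.
Definition gsize (G : sgraph) : nat := #|edges G|.

Definition deg (G : sgraph) (x : G) : nat := #|[set y | adj x y]|.

(* Every degree is below #|G|, so the neutral value #|G| does not affect the
   minimum unless G has no vertices; in that case the value is 0. *)
Definition min_deg (G : sgraph) : nat := \big[minn/#|G|]_(x : G) deg x.

Definition strong_dominating (G : sgraph) (D : {set G}) : bool :=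
  [forall x, (x \notin D) ==>
     [exists y in D, adj x y && (deg x <= deg y)]].

Lemma strong_dominating_setT (G : sgraph) : strong_dominating [set: G].
Proof. by apply/forallP => x; rewrite inE. Qed.

(* strong_dominating_setT makes this a genuine minimum. *)
Definition gamma_st (G : sgraph) : nat :=
  #|[arg min_(D < [set: G] | strong_dominating D) #|D|]|.

Section Subdivision.
Variables (G : sgraph) (k : nat).

(* Each edge is represented once, as an ordered pair of its ends; the auxiliary
   order enum_rank only fixes the direction in which its path is traversed. *)
Definition oriented_edge : finType :=
  {p : G * G | adj p.1 p.2 && (enum_rank p.1 < enum_rank p.2)}%type.

(* inr (p, j) is the (j+1)-st internal vertex of the path replacing p. *)
Definition subdiv_vertex : finType := (G + oriented_edge * 'I_k.-1)%type.

(* The vertex at distance i from (sval p).1 on the path of length k replacing p,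
   for 0 <= i <= k. *)
Definition path_vertex (p : oriented_edge) (i : nat) : subdiv_vertex :=
  if i == 0 then inl (sval p).1
  else if insub i.-1 is Some j then inr (p, j)
  else inl (sval p).2.

Definition path_step (x y : subdiv_vertex) : bool :=
  [exists p : oriented_edge, exists i : 'I_k,
     (x == path_vertex p i) && (y == path_vertex p i.+1)].

Definition subdiv_adj : rel subdiv_vertex :=
  fun x y => path_step x y || path_step y x.

Lemma subdiv_adj_sym : symmetric subdiv_adj.
Proof. by move=> x y; rewrite /subdiv_adj orbC. Qed.

Lemma path_vertex_neq (p : oriented_edge) (i : nat) :
  i < k -> path_vertex p i != path_vertex p i.+1.
Proof.
move=> ltik; have nuv : (sval p).1 != (sval p).2.
  have /andP[auv _] := svalP p.
  by apply: contraTneq auv => ->; rewrite adj_irrefl.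
rewrite /path_vertex /=; case: i ltik => [|i] ltik /=.
  by case: insubP => [//|_]; apply: contraNneq nuv => -[->].
case: insubP => [j _ ji|]; last by rewrite -ltnS (ltn_predK ltik) ltik.
case: insubP => [j' _ j'i|] //=.
by apply/eqP => -[ejj]; move: j'i; rewrite -ejj ji => /n_Sn.
Qed.

Lemma subdiv_adj_irrefl : irreflexive subdiv_adj.
Proof.
move=> x; rewrite /subdiv_adj orbb; apply/existsP => -[p /existsP[i]].
case/andP=> /eqP -> /eqP e; have := path_vertex_neq p (ltn_ord i).
by rewrite {1}e eqxx.
Qed.

Definition subdivision : sgraph := SGraph subdiv_adj_sym subdiv_adj_irrefl.

End Subdivision.

(* Main.v *)
Require Import Defs.
From mathcomp Require Import all_boot all_order all_algebra.
From mathcomp Require Import zify lra.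
Import Order.TTheory GRing.Theory Num.Theory.
Local Open Scope ring_scope.

(** On the path of length [k] that replaces an edge, number the vertices from
    [0] to [k], and let [D] consist of all original vertices and of the internal
    vertices whose number is a multiple of 3.  An internal vertex outside [D] has
    number [i] equal to 1 or 2 modulo 3, so its neighbour number [i - 1] or
    [i + 1] is a multiple of 3; that neighbour is in [D], because it is either
    internal or an end of the path.  Hence [D] is dominating.  It is strongly so
    because internal vertices have degree 2, while an original vertex keeps at
    least its degree in [G], which is at least 2.

    The end number [k] is in [D] whatever its residue modulo 3, so no separate
    choice is needed for the last vertices of a path.  Each path contributes
    [(k - 1) / 3] internal vertices, rounded down, which is 0 for [k <= 3] and
    equals [(k - 3) / 3] rounded up in general.  So a single estimate,
    [gamma_st_subdivision_le], gives both cases of the theorem. *)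

Lemma gamma_st_le (G : sgraph) (D : {set G}) :
  strong_dominating D -> (gamma_st G <= #|D|)%N.
Proof.
rewrite /gamma_st => domD.
case: arg_minnP => [|E _ minE]; first exact: strong_dominating_setT.
exact: minE.
Qed.

Lemma min_deg_le (G : sgraph) (x : G) : (min_deg G <= deg x)%N.
Proof. by rewrite /min_deg -minEnat -leEnat; apply: bigmin_le_cond. Qed.

Lemma card_multiples3 (n : nat) : #|[set j : 'I_n | 3 %| j.+1]%N| = (n %/ 3)%N.
Proof.
rewrite divn_count_dvd big_add1 /= big_mkord -sum1dep_card big_mkcond /=.
by apply: eq_bigr => j _; case: dvdn.
Qed.

(** The two ends of an oriented edge recover it, since the auxiliary order fixes
    which of them comes first. *)
Lemma card_oriented_edge (G : sgraph) : (#|oriented_edge G| <= gsize G)%N.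
Proof.
pose ends (p : oriented_edge G) : {set G} := [set (sval p).1; (sval p).2].
have ends_inj : injective ends.
  move=> p q /setP epq; apply: val_inj => /=.
  move: (svalP p) (svalP q) (epq (sval p).1) (epq (sval p).2).
  rewrite /ends !inE.
  case: (sval p) (sval q) => [a b] [c d] /= /andP[_ ltab] /andP[_ ltcd].
  rewrite !eqxx orbT /= => /esym/orP[]/eqP ea /esym/orP[]/eqP eb;
    subst a b => //; first by rewrite ltnn in ltab.
  - by have := ltn_trans ltab ltcd; rewrite ltnn.
  - by rewrite ltnn in ltab.
rewrite -cardsT -(card_imset _ ends_inj) /gsize; apply: subset_leq_card.
apply/subsetP => _ /imsetP[p _ ->]; rewrite inE.
apply/existsP; exists (sval p).1; apply/existsP; exists (sval p).2.
by have /andP[-> _] := svalP p; rewrite eqxx.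
Qed.

Section Subdivision.
Variables (G : sgraph) (k : nat).
Implicit Type p : oriented_edge G.

Lemma path_vertex_inr p (j : 'I_k.-1) : path_vertex k p j.+1 = inr (p, j).
Proof. by rewrite /path_vertex /= valK. Qed.

Lemma path_vertex_last p : (0 < k)%N ->
  path_vertex k p k = inl (sval p).2 :> subdiv_vertex G k.
Proof. by move=> k_gt0; rewrite /path_vertex eqn0Ngt k_gt0 /= insubF ?ltnn. Qed.

Lemma path_vertex_eq_inr p q (i : nat) (j : 'I_k.-1) :
  path_vertex k q i = inr (p, j) -> q = p /\ i = j.+1.
Proof.
rewrite /path_vertex; case: i => [//|i] /=.
by case: insubP => [j' _ <- [-> ->]|].
Qed.

(** A left inverse of [path_vertex k p]; the ends are told apart because [G] has
    no loops. *)
Definition position p (x : subdiv_vertex G k) : nat :=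
  match x with
  | inl v => if v == (sval p).1 then 0 else k
  | inr (_, j) => j.+1
  end.

Lemma path_vertexK p (i : nat) :
  (i <= k)%N -> position p (path_vertex k p i) = i.
Proof.
case: i => [|i] ltik; first by rewrite /= eqxx.
rewrite /path_vertex /=; case: insubP => [j _ <- //|] /=.
case: eqP => [e|_]; last by lia.
by have /andP[] := svalP p; rewrite e adj_irrefl.
Qed.

Lemma path_vertex_adj p (i : nat) : (i < k)%N ->
  @adj (subdivision G k) (path_vertex k p i) (path_vertex k p i.+1).
Proof.
move=> ltik; apply/orP; left; apply/existsP; exists p.
by apply/existsP; exists (Ordinal ltik); rewrite !eqxx.
Qed.

(** The two neighbours of an internal vertex on its path are distinct even when
    [k = 2], where they are the two ends of an edge of [G].  Equality, not just
    an upper bound, is used: internal vertices also dominate other ones. *)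
Lemma deg_internal p (j : 'I_k.-1) : @deg (subdivision G k) (inr (p, j)) = 2%N.
Proof.
have ltjk : (j.+1 < k)%N by have := ltn_ord j; lia.
have neq : path_vertex k p j != path_vertex k p j.+2 :> subdiv_vertex G k.
  apply/eqP => /(congr1 (position p)); rewrite !path_vertexK; lia.
suff -> : @deg (subdivision G k) (inr (p, j)) =
    #|[set (path_vertex k p j : subdiv_vertex G k); path_vertex k p j.+2]|.
  by rewrite cards2 neq.
rewrite /deg; congr #|pred_of_set _|; apply/setP => y; rewrite !inE.
apply/idP/orP => [/orP[]/existsP[q /existsP[i /andP[/eqP e1 /eqP e2]]]|].
- by have [eq ei] := path_vertex_eq_inr _ _ _ _ (esym e1); right; rewrite e2 eq ei.
- have [eq [ei]] := path_vertex_eq_inr _ _ _ _ (esym e2).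
  by left; rewrite e1 eq ei.
- case=> /eqP ->; rewrite -path_vertex_inr; last exact: path_vertex_adj.
  by rewrite adj_sym path_vertex_adj // ltnW.
Qed.

(** Reading off, from a neighbour of [v] inside a path, the other end of that
    path gives back every neighbour of [v] in [G]. *)
Lemma deg_original (v : G) : (1 < k)%N ->
  (deg v <= @deg (subdivision G k) (inl v))%N.
Proof.
move=> k_gt1.
pose other_end (x : subdiv_vertex G k) : G :=
  if x is inr (p, _) then if (sval p).1 == v then (sval p).2 else (sval p).1
  else v.
apply: leq_trans (leq_imset_card other_end _).
apply/subset_leq_card/subsetP => w; rewrite inE => avw.
have neqvw : (v == w) = false.
  by apply: contraTF avw => /eqP ->; rewrite adj_irrefl.
case: (ltngtP (enum_rank v) (enum_rank w)) => [ltvw|ltwv|/val_inj/enum_rank_inj].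
- have edge : adj (v, w).1 (v, w).2
      && (enum_rank (v, w).1 < enum_rank (v, w).2)%N by rewrite avw.
  pose p : oriented_edge G := exist _ (v, w) edge.
  have lt0k : (0 < k.-1)%N by lia.
  apply/imsetP; exists (inr (p, Ordinal lt0k)); last by rewrite /= eqxx.
  rewrite inE -path_vertex_inr; apply: (path_vertex_adj p 0); lia.
- have edge : adj (w, v).1 (w, v).2
      && (enum_rank (w, v).1 < enum_rank (w, v).2)%N by rewrite adj_sym avw.
  pose p : oriented_edge G := exist _ (w, v) edge.
  have ltk2 : (k.-2 < k.-1)%N by lia.
  apply/imsetP; exists (inr (p, Ordinal ltk2)); last by rewrite /= eq_sym neqvw.
  (* [v] is now the far end of the path, so its neighbour is number [k - 1]. *)
  have -> : inl v = path_vertex k p k.-2.+2 :> subdiv_vertex G k.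
    by rewrite (_ : k.-2.+2 = k) ?path_vertex_last //; lia.
  rewrite inE -path_vertex_inr adj_sym; apply: (path_vertex_adj p k.-2.+1); lia.
- by move/eqP; rewrite neqvw.
Qed.

(** All original vertices belong to the set, also those at the end of a path whose
    length is not a multiple of 3. *)
Definition every_third : {set subdivision G k} :=
  [set x : subdiv_vertex G k | if x is inr (_, j) then (3 %| j.+1)%N else true].

Lemma mem_every_third p (i : nat) :
  (3 %| i)%N || (i == k) -> path_vertex k p i \in every_third.
Proof.
rewrite inE /path_vertex; case: i => [//|i] /=.
case: insubP => [j ltik /= ->|//]; case/orP => [//|/eqP]; lia.
Qed.

Lemma card_every_third :
  (#|every_third| <= gorder G + gsize G * (k.-1 %/ 3))%N.
Proof.
pose J := [set j : 'I_k.-1 | 3 %| j.+1]%N.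
pose A : {set subdivision G k} := [set (inl v : subdiv_vertex G k) | v in [set: G]].
pose B : {set subdivision G k} :=
  [set (inr x : subdiv_vertex G k) | x in setX [set: oriented_edge G] J].
have sub : every_third \subset A :|: B.
  apply/subsetP => -[v _|[p j]]; rewrite inE; first by rewrite imset_f.
  move=> dvd3j; apply/setUP; right.
  by apply: imset_f; rewrite inE !inE.
apply: leq_trans (subset_leq_card sub) _.
apply: leq_trans (leq_card_setU A B) _; apply: leq_add.
  by rewrite /gorder -cardsT; apply: leq_imset_card.
apply: leq_trans (leq_imset_card _ _) _.
by rewrite cardsX cardsT card_multiples3 leq_mul2r card_oriented_edge orbT.
Qed.

Lemma every_third_strong_dominating : (2 <= min_deg G)%N -> (1 < k)%N ->
  strong_dominating every_third.
Proof.
move=> hdelta k_gt1; apply/forallP => -[v|[p j]]; apply/implyP.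
  by rewrite inE.
have deg_ge2 (y : subdivision G k) : (2 <= @deg (subdivision G k) y)%N.
  case: y => [v|[q l]]; last by rewrite deg_internal.
  by apply: leq_trans (deg_original v k_gt1); apply: leq_trans (min_deg_le G v).
have ltjk : (j.+1 < k)%N by have := ltn_ord j; lia.
rewrite inE => ndvd3j; apply/existsP.
(* The vertex has number [j + 1]; if 3 divides neither [j] nor [j + 1], it
   divides [j + 2]. *)
have [dvd3j|ndvd3] := boolP (3 %| j)%N.
  exists (path_vertex k p j); rewrite mem_every_third ?dvd3j // andTb.
  rewrite deg_internal deg_ge2 andbT -path_vertex_inr (@adj_sym (subdivision G k)).
  by apply: path_vertex_adj; apply: ltnW.
exists (path_vertex k p j.+2); rewrite mem_every_third ?andTb; last by lia.
rewrite deg_internal deg_ge2 andbT -path_vertex_inr.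
exact: path_vertex_adj.
Qed.

Lemma gamma_st_subdivision_le : (2 <= min_deg G)%N -> (1 < k)%N ->
  (gamma_st (subdivision G k) <= gorder G + gsize G * (k.-1 %/ 3))%N.
Proof.
move=> hdelta k_gt1; apply: leq_trans card_every_third.
exact/gamma_st_le/every_third_strong_dominating.
Qed.

End Subdivision.

(** With [q] the left-hand side, [k >= 3 * q + 1] gives
    [(k - 3) / 3 >= q - 2 / 3 > q - 1], and the ceiling is an integer. *)
Lemma div3_le_ceil (k : nat) : (0 < k)%N ->
  (k.-1 %/ 3)%N%:Z <= Num.ceil ((k%:Q - 3) / 3).
Proof.
move=> k_gt0; set q := (k.-1 %/ 3)%N.
have le3q : (3 * q + 1 <= k)%N by rewrite /q; lia.
suff : q%:Z - 1 < Num.ceil ((k%:Q - 3) / 3) by lia.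
rewrite ceil_gt_int intrD rmorphN /=.
have : (3 * q + 1)%:R <= k%:R :> rat by rewrite ler_nat.
rewrite natrD natrM -!pmulrn => le3qQ.
lra.
Qed.

Theorem theorem3p2 (G : sgraph) (k : nat)
    (hdelta : (2 <= min_deg G)%N) (hk : (2 <= k)%N) :
  (gamma_st (subdivision G k))%:Z <=
    if (k == 2%N) || (k == 3%N) then (gorder G)%:Z
    else (gorder G)%:Z + (gsize G)%:Z * Num.ceil ((k%:Q - 3) / 3).
Proof.
have := gamma_st_subdivision_le G k hdelta hk; rewrite -lez_nat => le_gamma.
apply: le_trans le_gamma _; case: ifP => [/orP[]/eqP -> /=|_].
- by rewrite muln0 addn0.
- by rewrite muln0 addn0.
- by rewrite PoszD PoszM lerD2l ler_wpM2l // div3_le_ceil // ltnW.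
Qed.
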